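(* Consider the convex problem with data $f_i,\mathcal X_i,A_i,\mathbf b,g_{ji}$ described in the context, and assume: (i) (Slater) there exist $\bar{\mathbf x}_i\in \mathrm{relint}(\mathcal X_i)$, $i=1,\dots,N$, with $\sum_{i=1}^N A_i\bar{\mathbf x}_i=\mathbf b$ and $\sum_{i=1}^N g_{ji}(\bar{\mathbf x}_i)<0$ for all $j=1,\dots,M$; (ii) (Lipschitz continuity) for all $i,j$, $|g_{ji}(\mathbf x)-g_{ji}(\mathbf y)|\le L_{ji}\|\mathbf x-\mathbf y\|_2$ for all $\mathbf x,\mathbf y\in\mathcal X_i$; (iii) a saddle point of the Lagrangian $\mathcal L$ exists; (iv) (Lipschitz inverse mapping) the saddle point $(\mathbf x_1^*,\dots,\mathbf x_N^*,\bm\lambda^*,\bm\mu^* )$ is unique, and there are $\tau>0$ and $a\ge0$ such that $$\sum_{i=1}^N\|\mathbf x_i-\mathbf x_i^*\|_2^2+\|\bm\lambda-\bm\lambda^*\|_2^2+\|\bm\mu-\bm\mu^*\|_2^2\le a^2\Big(\sum_{i=1}^N\|\mathbf u_i\|_2^2+\|\mathbf v\|_2^2+\|\mathbf w\|_2^2\Big)$$ whenever $(\mathbf x_1,\dots,\mathbf x_N,\bm\lambda,\bm\mu)\in\mathcal S^{-1}(\mathbf u_1,\dots,\mathbf u_N,\mathbf v,\mathbf w)$ and $\sum_{i}\|\mathbf u_i\|_2^2+\|\mathbf v\|_2^2+\|\mathbf w\|_2^2\le\tau^2$. Given $0<\epsilon<1$, let $\rho$ satisfy $$0<\rho\le\min\left\{\frac{1-\epsilon}{A_{max}+M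 L_{max}},\ \frac{1-\epsilon}{N A_{max}},\ \frac{1-\epsilon}{N L_{max}}\right\},$$ where $A_{max}=\max_i\|A_i\|_2$ (spectral norms) and $L_{max}=\max_{j}\max_{i}L_{ji}$. Let $\{(\mathbf x_1^k,\dots,\mathbf x_N^k,\bm\lambda^k,\bm\mu^k)\}_{k\ge0}$ be the sequence generated by the $N$-PCPM algorithm with step size $\rho$ from an arbitrary starting point. Then the sequence converges linearly to the unique saddle point; more specifically, there exist $\theta$ with $0<\theta<1$ and an integer $\bar k$ such that for all $k\ge\bar k$, $$\sum_{i=1}^N\|\mathbf x_i^{k+1}-\mathbf x_i^*\|_2^2+\|\bm\lambda^{k+1}-\bm\lambda^*\|_2^2+\|\bm\mu^{k+1}-\bm\mu^*\|_2^2\le\theta^2\Big(\sum_{i=1}^N\|\mathbf x_i^{k}-\mathbf x_i^*\|_2^2+\|\bm\lambda^{k}-\bm\lambda^*\|_2^2+\|\bm\mu^{k}-\bm\mu^*\|_2^2\Big).$$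
   Context: Problem: minimize $\sum_{i=1}^N f_i(\mathbf x_i)$ over $\mathbf x_i\in\mathcal X_i$, $i=1,\dots,N$, subject to $\sum_{i=1}^N A_i\mathbf x_i=\mathbf b$ and $\sum_{i=1}^N g_{ji}(\mathbf x_i)\le 0$ for $j=1,\dots,M$. Here $\mathcal X_i\subset\mathbb R^{n_i}$ is closed and convex, $\sum_i n_i=n$, $f_i:\mathbb R^{n_i}\to\mathbb R$ and $g_{ji}:\mathbb R^{n_i}\to\mathbb R$ are continuous and convex, $A_i\in\mathbb R^{m\times n_i}$, $\mathbf b\in\mathbb R^m$. Lagrangian: $\mathcal L(\mathbf x_1,\dots,\mathbf x_N,\bm\lambda,\bm\mu)=\sum_{i} f_i(\mathbf x_i)+\bm\lambda^T(\sum_i A_i\mathbf x_i-\mathbf b)+\sum_{j}\mu_j\sum_i g_{ji}(\mathbf x_i)$. A saddle point is a point $(\mathbf x_1^*,\dots,\mathbf x_N^*,\bm\lambda^*,\bm\mu^* )\in\prod_i\mathcal X_i\times\mathbb R^m\times\mathbb R_+^M$ such that $\mathcal L(\mathbf x^*,\bm\lambda,\bm\mu)\le\mathcal L(\mathbf x^*,\bm\lambda^*,\bm\mu^* )\le\mathcal L(\mathbf x,\bm\lambda^*,\bm\mu^* )$ for all $\mathbf x\in\prod_i\mathcal X_i$, $\bm\lambda\in\mathbb R^m$, $\bm\mu\in\mathbb R_+^M$. Inverse mapping: for $\mathbf u_i\in\mathbb R^{n_i}$, $\mathbf v\in\mathbb R^m$, $\mathbf w\in\mathbb R^M$, the set $\mathcal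 S^{-1}(\mathbf u_1,\dots,\mathbf u_N,\mathbf v,\mathbf w)\subset\prod_i\mathcal X_i\times\mathbb R^m\times\mathbb R_+^M$ is $$\arg\min_{(\mathbf x_1,\dots,\mathbf x_N)\in\prod_i\mathcal X_i}\ \max_{\bm\lambda\in\mathbb R^m,\ \bm\mu\in\mathbb R_+^M}\Big\{\mathcal L(\mathbf x_1,\dots,\mathbf x_N,\bm\lambda,\bm\mu)-\sum_i\mathbf x_i^T\mathbf u_i+\bm\lambda^T\mathbf v+\bm\mu^T\mathbf w\Big\},$$ i.e. the set of saddle points (minimizing in $\mathbf x$ over $\prod_i\mathcal X_i$, maximizing in $(\bm\lambda,\bm\mu)$ over $\mathbb R^m\times\mathbb R_+^M$) of the perturbed Lagrangian in braces. $N$-PCPM algorithm with step size $\rho>0$: given $(\mathbf x_1^k,\dots,\mathbf x_N^k,\bm\lambda^k,\bm\mu^k)$, compute for $k=0,1,2,\dots$ (with $\Pi_{\mathbb R_+}$ the projection onto $[0,\infty)$) (predictor) $\bm\gamma^{k+1}=\bm\lambda^k+\rho(\sum_i A_i\mathbf x_i^k-\mathbf b)$, $\nu_j^{k+1}=\Pi_{\mathbb R_+}[\mu_j^k+\rho\sum_i g_{ji}(\mathbf x_i^k)]$, $j=1,\dots,M$; (primal) $\mathbf x_i^{k+1}=\arg\min_{\mathbf x_i\in\mathcal X_i} f_i(\mathbf x_i)+(\bm\gamma^{k+1})^TA_i\mathbf x_i+\sum_{j=1}^M\nu_j^{k+1}g_{ji}(\mathbf x_i)+\frac1{2\rho}\|\mathbf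 x_i-\mathbf x_i^k\|_2^2$, $i=1,\dots,N$; (corrector) $\bm\lambda^{k+1}=\bm\lambda^k+\rho(\sum_i A_i\mathbf x_i^{k+1}-\mathbf b)$, $\mu_j^{k+1}=\Pi_{\mathbb R_+}[\mu_j^k+\rho\sum_i g_{ji}(\mathbf x_i^{k+1})]$, $j=1,\dots,M$. *)

(* Defs.v *)
From HB Require Import structures.
From mathcomp Require Export all_boot all_order all_algebra.
From mathcomp Require Export all_classical all_reals all_analysis.
Export Order.TTheory GRing.Theory Num.Theory.
Export numFieldNormedType.Exports.

Set Implicit Arguments.
Unset Strict Implicit.
Unset Printing Implicit Defensive.

Local Open Scope classical_set_scope.
Local Open Scope ring_scope.

Section Euclidean.
Context {R : realType}.

Definition dot p (u v : 'cV[R]_p) : R := \sum_(k < p) u k 0 * v k 0.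

(* The library norm on matrices is the sup norm; it induces the same topology,
   so closedness, continuity and convergence use the library notions. *)
Definition norm2 p (u : 'cV[R]_p) : R := Num.sqrt (dot u u).

Definition spectral_norm p q (A : 'M[R]_(p, q)) : R :=
  sup [set norm2 (A *m x) | x in [set x : 'cV[R]_q | norm2 x <= 1]].

Definition affine_hull p (X : set 'cV[R]_p) : set 'cV[R]_p :=
  [set y | exists (k : nat) (t : 'I_k -> R) (x : 'I_k -> 'cV[R]_p),
     [/\ forall l, X (x l), \sum_l t l = 1 & y = \sum_l t l *: x l]].

Definition relint p (X : set 'cV[R]_p) : set 'cV[R]_p :=
  [set x | X x /\ \forall y \near x, affine_hull X y -> X y].

Definition argmin p (X : set 'cV[R]_p) (h : 'cV[R]_p -> R) : set 'cV[R]_p :=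
  [set x | X x /\ forall y, X y -> h x <= h y].

End Euclidean.

Record convex_program (R : realType) (N M m : nat) (n : 'I_N -> nat) :=
  ConvexProgram {
    dom : forall i : 'I_N, set 'cV[R]_(n i);
    obj : forall i : 'I_N, 'cV[R]_(n i) -> R;
    ineq : forall (j : 'I_M) (i : 'I_N), 'cV[R]_(n i) -> R;
    eqmat : forall i : 'I_N, 'M[R]_(m, n i);
    rhs : 'cV[R]_m;
    dom_closed : forall i, closed (@dom i);
    dom_convex : forall i, convex_set (@dom i);
    obj_continuous : forall i, continuous (@obj i);
    obj_convex : forall i, convex_function [set: 'cV[R]_(n i)] (@obj i);
    ineq_continuous : forall j i, continuous (@ineq j i);
    ineq_convex : forall j i,
      convex_function [set: 'cV[R]_(n i)] (@ineq j i)
  }.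
Arguments dom {R N M m n} _ i _.
Arguments obj {R N M m n} _ {i} _.
Arguments ineq {R N M m n} _ j {i} _.
Arguments eqmat {R N M m n} _ i.

Record primal_dual (R : realType) (N M m : nat) (n : 'I_N -> nat) :=
  PrimalDual {
    px : forall i : 'I_N, 'cV[R]_(n i);
    plam : 'cV[R]_m;
    pmu : 'cV[R]_M
  }.

Section Program.
Context {R : realType} {N M m : nat} {n : 'I_N -> nat}.
Variable P : convex_program R M m n.

Local Notation blocks := (forall i : 'I_N, 'cV[R]_(n i)).
Local Notation point := (primal_dual R M m n).

Definition sqnorm (x : blocks) (lam : 'cV[R]_m) (mu : 'cV[R]_M) : R :=
  \sum_(i < N) norm2 (x i) ^+ 2 + norm2 lam ^+ 2 + norm2 mu ^+ 2.

Definition sqdist (z z' : point) : R :=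
  sqnorm (fun i => px z i - px z' i) (plam z - plam z') (pmu z - pmu z').

Definition eq_residual (x : blocks) : 'cV[R]_m :=
  \sum_(i < N) eqmat P i *m x i - rhs P.

Definition ineq_value (x : blocks) (j : 'I_M) : R :=
  \sum_(i < N) ineq P j (x i).

Definition slater : Prop :=
  exists x : blocks, [/\ forall i, relint (dom P i) (x i),
    \sum_(i < N) eqmat P i *m x i = rhs P & forall j, ineq_value x j < 0].

Definition lagrangian (x : blocks) (lam : 'cV[R]_m) (mu : 'cV[R]_M) : R :=
  \sum_(i < N) obj P (x i) + dot lam (eq_residual x)
  + \sum_(j < M) mu j 0 * ineq_value x j.

Definition primal_feasible (x : blocks) : Prop := forall i, dom P i (x i).

Definition nonneg (mu : 'cV[R]_M) : Prop := forall j, 0 <= mu j 0.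

Definition saddle_points (F : blocks -> 'cV[R]_m -> 'cV[R]_M -> R) :
    set point :=
  [set z | [/\ primal_feasible (px z), nonneg (pmu z),
     forall lam mu, nonneg mu ->
       F (px z) lam mu <= F (px z) (plam z) (pmu z) &
     forall x, primal_feasible x ->
       F (px z) (plam z) (pmu z) <= F x (plam z) (pmu z)]].

Definition perturbed_lagrangian (u : blocks) (v : 'cV[R]_m) (w : 'cV[R]_M)
    (x : blocks) (lam : 'cV[R]_m) (mu : 'cV[R]_M) : R :=
  lagrangian x lam mu - \sum_(i < N) dot (x i) (u i) + dot lam v + dot mu w.

Definition inverse_map (u : blocks) (v : 'cV[R]_m) (w : 'cV[R]_M) :
    set point :=
  saddle_points (perturbed_lagrangian u v w).

Definition lambda_step (rho : R) (lam : 'cV[R]_m) (x : blocks) : 'cV[R]_m :=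
  lam + rho *: eq_residual x.

Definition mu_step (rho : R) (mu : 'cV[R]_M) (x : blocks) : 'cV[R]_M :=
  \col_j Num.max 0 (mu j 0 + rho * ineq_value x j).

Definition prox_objective (rho : R) (gam : 'cV[R]_m) (nu : 'cV[R]_M)
    (i : 'I_N) (c y : 'cV[R]_(n i)) : R :=
  obj P y + dot gam (eqmat P i *m y) + \sum_(j < M) nu j 0 * ineq P j y
  + (2 * rho)^-1 * norm2 (y - c) ^+ 2.

Definition NPCPM_step (rho : R) (z z' : point) : Prop :=
  let gam := lambda_step rho (plam z) (px z) in
  let nu := mu_step rho (pmu z) (px z) in
  [/\ forall i, argmin (dom P i) (prox_objective rho gam nu (px z i)) (px z' i),
      plam z' = lambda_step rho (plam z) (px z') &
      pmu z' = mu_step rho (pmu z) (px z')].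

Definition NPCPM_sequence (rho : R) (z : nat -> point) : Prop :=
  forall k, NPCPM_step rho (z k) (z k.+1).

(* Spectral norms and Lipschitz constants are nonnegative, so the default value
   0 of these maxima only matters when N = 0 or M = 0. *)
Definition A_max : R := \big[Num.max/0]_(i < N) spectral_norm (eqmat P i).

Definition L_max (L : 'I_M -> 'I_N -> R) : R :=
  \big[Num.max/0]_(j < M) \big[Num.max/0]_(i < N) L j i.

(* Extended reals, where x / 0 = +oo for x > 0: a vanishing denominator
   imposes no restriction on the step size, whereas the division of R
   would make the bound 0. *)
Definition step_bound (eps : R) (L : 'I_M -> 'I_N -> R) : \bar R :=
  let e := (1 - eps)%:E in
  Order.min (e / (A_max + M%:R * L_max L)%:E)%E
    (Order.min (e / (N%:R * A_max)%:E)%E (e / (N%:R * L_max L)%:E)%E).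

End Program.

(* Main.v *)
Require Import Defs.
From mathcomp Require Import ring lra.

(** One step maps z = (x, lambda, mu) to z' through the predictor point
    w = (x', gamma, nu), whose multipliers are the predicted ones and whose
    primal part is already the new one.  In the multipliers this is an
    extragradient step on the Lagrangian: gamma and nu use the constraint
    values at x, and z' corrects them with the values at x'.  Put
    E = |z - w|^2 + |w - z'|^2.  Two facts about w give the linear rate.

    Descent.  The projection inequalities for gamma, nu, lambda', mu'
    ([extragradient_inequality]), optimality of x' in the proximal problem
    ([primal_step_optimality]) and the saddle inequalities for the saddle
    point zs combine to
    |z' - zs|^2 <= |z - zs|^2 - E + (cross terms),
    where the cross terms pair z' - w with the change of the constraint values
    between x and x'.  By Cauchy-Schwarz and the Lipschitz bounds, the three
    restrictions on the step size are what makes the cross terms at most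
    (1 - eps) E, so that |z' - zs|^2 <= |z - zs|^2 - eps E
    ([sqdist_descent]).  In particular the decreases of |z - zs|^2, hence E,
    tend to 0.

    Error bound.  The optimality conditions that define w say exactly that w
    is a saddle point of a Lagrangian perturbed by residuals of size O(sqrt E)
    ([predictor_point_in_inverse_map], [predictor_residual_le]).  Once E is
    small, the Lipschitz property of the inverse mapping bounds |w - zs|^2,
    and then |z' - zs|^2, by a constant times E ([sqdist_next_le]).

    With B that constant, |z' - zs|^2 <= (B / eps) (|z - zs|^2 - |z' - zs|^2),
    which is a contraction of the squared distance by K / (1 + K) for
    K = B / eps ([linear_rate_of_descent]).

    The descent needs x in the domain, where the constraints are Lipschitz.
    An arbitrary starting point need not satisfy this, so everything is used
    from the first computed iterate on. *)

Set Implicit Arguments.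
Unset Strict Implicit.
Unset Printing Implicit Defensive.

Local Open Scope classical_set_scope.
Local Open Scope ring_scope.

(** * Euclidean geometry of column vectors *)

Section Euclidean.
Context {R : realType}.
Implicit Types (p q : nat).

Lemma dotC p (u v : 'cV[R]_p) : dot u v = dot v u.
Proof. by apply: eq_bigr => k _; rewrite mulrC. Qed.

Lemma dotDr p (u v w : 'cV[R]_p) : dot u (v + w) = dot u v + dot u w.
Proof. by rewrite -big_split; apply: eq_bigr => k _; rewrite mxE mulrDr. Qed.

Lemma dotZr p (t : R) (u v : 'cV[R]_p) : dot u (t *: v) = t * dot u v.
Proof. by rewrite mulr_sumr; apply: eq_bigr => k _; rewrite mxE mulrCA. Qed.

Lemma dotDl p (u v w : 'cV[R]_p) : dot (u + v) w = dot u w + dot v w.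
Proof. by rewrite !(dotC _ w) dotDr. Qed.

Lemma dotZl p (t : R) (u v : 'cV[R]_p) : dot (t *: u) v = t * dot u v.
Proof. by rewrite !(dotC _ v) dotZr. Qed.

Lemma dotNr p (u v : 'cV[R]_p) : dot u (- v) = - dot u v.
Proof. by rewrite -scaleN1r dotZr mulN1r. Qed.

Lemma dotNl p (u v : 'cV[R]_p) : dot (- u) v = - dot u v.
Proof. by rewrite !(dotC _ v) dotNr. Qed.

Lemma dot0r p (u : 'cV[R]_p) : dot u 0 = 0.
Proof. by rewrite -(scale0r 0) dotZr mul0r. Qed.

Lemma dot_sumr p I (r : seq I) (u : 'cV[R]_p) (F : I -> 'cV[R]_p) :
  dot u (\sum_(i <- r) F i) = \sum_(i <- r) dot u (F i).
Proof.
by elim/big_rec2: _ => [|i y1 y2 _ <-]; rewrite ?dot0r ?dotDr.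
Qed.

Definition dotE := (dotDl, dotDr, dotNl, dotNr, dotZl, dotZr).

Lemma dot_ge0 p (u : 'cV[R]_p) : 0 <= dot u u.
Proof. by apply: sumr_ge0 => k _; rewrite -expr2 sqr_ge0. Qed.

Lemma norm2_ge0 p (u : 'cV[R]_p) : 0 <= norm2 u.
Proof. exact: sqrtr_ge0. Qed.

Lemma norm2_sqr p (u : 'cV[R]_p) : norm2 u ^+ 2 = dot u u.
Proof. by rewrite sqr_sqrtr// dot_ge0. Qed.

Lemma norm2Z p (t : R) (u : 'cV[R]_p) : norm2 (t *: u) = `|t| * norm2 u.
Proof.
by rewrite /norm2 dotZl dotZr mulrA -expr2 sqrtrM ?sqr_ge0// sqrtr_sqr.
Qed.

Lemma norm2_0 p : norm2 (0 : 'cV[R]_p) = 0.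
Proof. by rewrite /norm2 dot0r sqrtr0. Qed.

Lemma norm2BC p (u v : 'cV[R]_p) : norm2 (u - v) = norm2 (v - u).
Proof. by rewrite -opprB -scaleN1r norm2Z normrN1 mul1r. Qed.

Lemma entry_le_norm2 p (u : 'cV[R]_p) k : `|u k 0| <= norm2 u.
Proof.
rewrite -(@ler_pXn2r _ 2) ?nnegrE ?norm2_ge0// norm2_sqr real_normK ?num_real//.
rewrite /dot (bigD1 k)//= -expr2 lerDl; apply: sumr_ge0 => i _.
by rewrite -expr2 sqr_ge0.
Qed.

(** Relates the Euclidean norm to the sup norm, in which limits of matrices are
    taken. *)
Lemma norm_le_norm2 p (u : 'cV[R]_p) : `|u| <= norm2 u.
Proof.
rewrite /Num.Def.normr/= mx_normrE; apply: bigmax_le; first exact: norm2_ge0.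
by move=> [k j] _ /=; rewrite ord1 entry_le_norm2.
Qed.

Lemma norm2_eq0 p (u : 'cV[R]_p) : norm2 u = 0 -> u = 0.
Proof.
move=> u0; apply/matrixP => k j; rewrite ord1 mxE; apply/eqP.
by rewrite -normr_le0 -u0 entry_le_norm2.
Qed.

Lemma dot_le_norm2 p (u v : 'cV[R]_p) : dot u v <= norm2 u * norm2 v.
Proof.
have [/norm2_eq0 ->|u0] := eqVneq (norm2 u) 0.
  by rewrite dotC dot0r mulr_ge0 ?norm2_ge0.
have [/norm2_eq0 ->|v0] := eqVneq (norm2 v) 0.
  by rewrite dot0r mulr_ge0 ?norm2_ge0.
have uv0 : 0 < norm2 u * norm2 v.
  by rewrite mulr_gt0// lt_neqAle norm2_ge0 eq_sym ?u0 ?v0.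
have := dot_ge0 (norm2 v *: u - norm2 u *: v).
rewrite !dotE -!norm2_sqr (dotC v u) => h.
(* h is 0 <= 2 |u| |v| (|u| |v| - dot u v). *)
rewrite -(ler_pM2l uv0); nra.
Qed.

Lemma norm2D_sqr_le p (u v : 'cV[R]_p) :
  norm2 (u + v) ^+ 2 <= 2 * (norm2 u ^+ 2 + norm2 v ^+ 2).
Proof.
rewrite !norm2_sqr; have := dot_ge0 (u - v).
rewrite !dotE (dotC v u); lra.
Qed.

(** The supremum that defines the spectral norm is a junk value unless this
    holds.  A crude bound suffices: the entries of x are at most 1 when
    |x| <= 1. *)
Lemma spectral_norm_has_sup p q (A : 'M[R]_(p, q)) :
  has_sup [set norm2 (A *m x) | x in [set x : 'cV[R]_q | norm2 x <= 1]].
Proof.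
split.
  by exists (norm2 (A *m 0)), 0 => //=; rewrite norm2_0.
exists (Num.sqrt (\sum_(i < p) (\sum_(k < q) `|A i k|) ^+ 2)) => _ [x /= x1 <-].
rewrite ler_wsqrtr//; apply: ler_sum => i _; rewrite -expr2.
rewrite -real_normK ?num_real// ler_pXn2r ?nnegrE ?sumr_ge0// mxE.
apply: le_trans (ler_norm_sum _ _ _) _; apply: ler_sum => k _.
by rewrite normrM ler_piMr// (le_trans (entry_le_norm2 x k)).
Qed.

Lemma norm2_mulmx_le p q (A : 'M[R]_(p, q)) (x : 'cV[R]_q) :
  norm2 (A *m x) <= spectral_norm A * norm2 x.
Proof.
have [/norm2_eq0 ->|x0] := eqVneq (norm2 x) 0.
  by rewrite mulmx0 !norm2_0 mulr0.
have xp : 0 < norm2 x by rewrite lt_neqAle norm2_ge0 eq_sym x0.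
rewrite -ler_pdivrMr// /spectral_norm; apply: ub_le_sup.
  by have [] := spectral_norm_has_sup A.
exists ((norm2 x)^-1 *: x) => /=.
  by rewrite norm2Z ger0_norm ?invr_ge0 ?norm2_ge0// mulVf.
by rewrite -scalemxAr norm2Z ger0_norm ?invr_ge0 ?norm2_ge0// mulrC.
Qed.

(** * Projection and proximal inequalities *)

Lemma convex_functionP p (h : 'cV[R]_p -> R) :
  convex_function [set: 'cV[R]_p] h <->
  forall (t : R) (x y : 'cV[R]_p), 0 <= t <= 1 ->
    h (t *: x + (1 - t) *: y) <= t * h x + (1 - t) * h y.
Proof.
split=> [hc t x y /andP[t0 t1]|hc t x y _ _].
  exact: (hc (Itv01 t0 t1) x y (in_setT _) (in_setT _)).
have t01 : 0 <= t%:num <= 1 by rewrite ge0 le1.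
exact: hc t01.
Qed.

Lemma convex_setP p (X : set 'cV[R]_p) (t : R) x y :
  convex_set X -> 0 <= t <= 1 -> X x -> X y -> X (t *: x + (1 - t) *: y).
Proof.
move=> Xc /andP[t0 t1] Xx Xy; apply/set_mem.
exact: (Xc x y (Itv01 t0 t1) (mem_set Xx) (mem_set Xy)).
Qed.

Lemma le0_of_small_slope (d C : R) :
  0 <= C -> (forall t, 0 < t <= 1 -> d <= t * C) -> d <= 0.
Proof.
move=> C0 dC; rewrite leNgt; apply/negP => d0.
have dC0 : 0 < d + C by rewrite ltr_pwDl.
(* This t makes t * C = d * C / (d + C) smaller than d. *)
have := dC (d / (d + C)).
rewrite divr_gt0// ler_pdivrMr// mul1r lerDl C0 => /(_ isT).
rewrite mulrAC ler_pdivlMr//; nra.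
Qed.

(** The first-order condition of the proximal problem, without subgradients:
    comparing x with the points t y + (1 - t) x, convexity of h leaves the
    claim up to an error t |y - x|^2 / (2 rho), which vanishes with t. *)
Lemma prox_optimality p (X : set 'cV[R]_p) (h : 'cV[R]_p -> R) rho c x y :
  convex_set X -> convex_function [set: 'cV[R]_p] h -> 0 < rho ->
  argmin X (fun y => h y + (2 * rho)^-1 * norm2 (y - c) ^+ 2) x -> X y ->
  h x <= h y + rho^-1 * dot (x - c) (y - x).
Proof.
move=> Xc /convex_functionP hc rho0 [Xx xmin] Xy.
have r0 : 0 < rho^-1 by rewrite invr_gt0.
rewrite -subr_le0.
apply: (@le0_of_small_slope _ (rho^-1 / 2 * norm2 (y - x) ^+ 2)).
  by rewrite mulr_ge0 ?sqr_ge0// divr_ge0// ltW.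
move=> t /andP[t0 t1].
have t01 : 0 <= t <= 1 by rewrite ltW.
have := xmin _ (convex_setP Xc t01 Xy Xx).
have := hc t y x t01.
rewrite (_ : t *: y + (1 - t) *: x - c = (x - c) + t *: (y - x)); last first.
  by apply/matrixP => k j; rewrite !mxE; ring.
rewrite invfM !norm2_sqr.
move: (x - c) (y - x) => u v; rewrite !dotE (dotC v u) => h1 h2.
rewrite -(ler_pM2l t0); nra.
Qed.

(** The variational characterization of the projection onto the nonnegative
    orthant. *)
Lemma proj_orthant_vi p (u v : 'cV[R]_p) : nonneg v ->
  dot (v - \col_j Num.max 0 (u j 0)) (u - \col_j Num.max 0 (u j 0)) <= 0.
Proof.
move=> v0; apply: sumr_le0 => j _; rewrite !mxE.
have [u0|u0] := leP 0 (u j 0); first by rewrite subrr mulr0.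
by rewrite !subr0 mulr_ge0_le0 // ltW.
Qed.

(** The two hypotheses say that w and y are projections of c + rho g and
    c + rho g', each tested at one point: the predictor w at the corrected
    point y, and y at the reference point s.  Testing the predictor at y
    rather than at s is what turns the error into the pairing of y - w with
    g' - g, a product of two small quantities. *)
Lemma extragradient_inequality p rho (s c w y g g' : 'cV[R]_p) :
  dot (y - w) (c + rho *: g - w) <= 0 ->
  dot (s - y) (c + rho *: g' - y) <= 0 ->
  norm2 (y - s) ^+ 2 <= norm2 (c - s) ^+ 2
    - (norm2 (c - w) ^+ 2 + norm2 (w - y) ^+ 2)
    + 2 * rho * dot (w - s) g' + 2 * rho * dot (y - w) (g' - g).
Proof.
rewrite !norm2_sqr !dotE (dotC y c) (dotC y w) (dotC w c) (dotC s c) (dotC s y).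
lra.
Qed.

Lemma three_point_identity p (s c y : 'cV[R]_p) :
  norm2 (y - s) ^+ 2 = norm2 (c - s) ^+ 2 - norm2 (c - y) ^+ 2
    - 2 * dot (y - c) (s - y).
Proof.
rewrite !norm2_sqr !dotE (dotC y c) (dotC s c) (dotC s y); ring.
Qed.
End Euclidean.

(** * The step size *)

Section StepBound.
Context {R : realType}.

(** A zero denominator makes the quotient +oo, but then the product on the
    left is 0. *)
Lemma le_ereal_div (rho e d : R) : 0 <= e -> 0 <= d ->
  (rho%:E <= e%:E / d%:E)%E -> rho * d <= e.
Proof.
move=> e0 d0; rewrite inver; have [->|dn0] := eqVneq d 0.
  by rewrite mulr0.
by rewrite -EFinM lee_fin ler_pdivlMr// lt_neqAle eq_sym dn0.
Qed.

Lemma step_boundP N M m (n : 'I_N -> nat) (P : convex_program R M m n)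
    (L : 'I_M -> 'I_N -> R) (eps rho : R) : eps < 1 ->
  (rho%:E <= step_bound P eps L)%E ->
  [/\ rho * (A_max P + M%:R * L_max L) <= 1 - eps,
      rho * (N%:R * A_max P) <= 1 - eps &
      rho * (N%:R * L_max L) <= 1 - eps].
Proof.
move=> eps1; rewrite /step_bound !le_min => /and3P[h1 h2 h3].
have e0 : 0 <= 1 - eps by lra.
have A0 : 0 <= A_max P by exact: bigmax_ge_id.
have L0 : 0 <= L_max L by exact: bigmax_ge_id.
by split; apply: le_ereal_div => //; rewrite ?addr_ge0 ?mulr_ge0.
Qed.
End StepBound.

(** * From descent and an error bound to a linear rate *)

Section Rate.
Context {R : realType}.
Implicit Types D E : nat -> R.

Lemma nonincreasing_gap_cvg0 D :
  (forall k, 0 <= D k) -> (forall k, D k.+1 <= D k) ->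
  (D k - D k.+1) @[k --> \oo] --> (0 : R).
Proof.
move=> D0 Ddec.
have cD : cvgn D.
  apply: nonincreasing_is_cvgn; first exact/nonincreasing_seqP.
  by exists 0 => _ [k _ <-].
have cDS : D k.+1 @[k --> \oo] --> limn D by rewrite (cvg_shiftS D).
by rewrite -(subrr (limn D)); exact: cvgB.
Qed.

(** D is the squared distance to the solution and E the squared length of a
    step.  Descent forces E to 0, so the error bound, valid for small steps
    only, holds eventually; there D' <= (B / eps) (D - D').  The index 0 is
    excluded because the starting point is arbitrary. *)
Lemma linear_rate_of_descent D E (eps B del : R) :
  0 < eps -> 0 < B -> 0 < del ->
  (forall k, 0 <= D k) -> (forall k, 0 <= E k) ->
  (forall k, D k.+2 <= D k.+1 - eps * E k.+1) ->
  (forall k, E k.+1 <= del -> D k.+2 <= B * E k.+1) ->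
  D k @[k --> \oo] --> (0 : R) /\
  exists (theta : R) (kbar : nat), 0 < theta < 1 /\
    forall k, (kbar <= k)%N -> D k.+1 <= theta ^+ 2 * D k.
Proof.
move=> eps0 B0 del0 D0 E0 descent errbound.
pose K := B / eps; have K0 : 0 < K by rewrite divr_gt0.
have gapE k : E k.+1 <= (D k.+1 - D k.+2) / eps.
  by rewrite ler_pdivlMr// mulrC; have := descent k; lra.
have gap0 : (D k.+1 - D k.+2) @[k --> \oo] --> (0 : R).
  apply: (nonincreasing_gap_cvg0 (D := fun k => D k.+1)) => // k.
  have := descent k; have := mulr_ge0 (ltW eps0) (E0 k.+1); lra.
have [k0 _ hk0] : \forall k \near \oo, D k.+1 - D k.+2 < eps * del.
  by apply: (cvgr_lt 0) gap0 _ _; rewrite mulr_gt0.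
have bound k : (k0 <= k)%N -> D k.+2 <= K * (D k.+1 - D k.+2).
  move=> /hk0 /= hk; have hE : E k.+1 <= del.
    by apply: le_trans (gapE k) _; rewrite ler_pdivrMr// mulrC ltW.
  apply: le_trans (errbound k hE) _.
  by rewrite /K mulrAC -mulrA ler_pM2l.
split.
  have -> : (0 : R) = K * 0 by rewrite mulr0.
  rewrite -(cvg_shiftn 2%N).
  apply: (@squeeze_cvgr _ _ _ _ (fun=> 0) (fun k => K * (D k.+1 - D k.+2))).
  - by exists k0 => // k /= /bound; rewrite addn2 D0.
  - by rewrite mulr0; exact: cvg_cst.
  - exact: cvgM (cvg_cst K) gap0.
(* Solving D' <= K (D - D') for D' gives the factor K / (1 + K). *)
have K1 : 0 < 1 + K by lra.
exists (Num.sqrt (K / (1 + K))), k0.+1; split.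
  by rewrite sqrtr_gt0 divr_gt0//= -[ltRHS]sqrtr1 ltr_sqrt// ltr_pdivrMr//; lra.
case=> // k /bound hk.
rewrite sqr_sqrtr ?divr_ge0 ?(ltW K0) ?(ltW K1) ?(ltW B0) ?(ltW eps0)//.
rewrite mulrAC ler_pdivlMr//; lra.
Qed.
Lemma cvg_of_norm2 D p (f : nat -> 'cV[R]_p) (l : 'cV[R]_p) :
  D k @[k --> \oo] --> (0 : R) ->
  (forall k, norm2 (f k - l) ^+ 2 <= D k) -> f k @[k --> \oo] --> l.
Proof.
move=> D0 fD; apply/cvgrPdist_lt => e e0.
have e20 : 0 < e ^+ 2 by rewrite exprn_gt0.
have [k0 _ hk0] := cvgr_lt 0 D0 _ e20.
exists k0 => // k /hk0 /= hk; rewrite distrC.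
apply: le_lt_trans (norm_le_norm2 _) _.
rewrite -(@ltr_pXn2r _ 2) ?nnegrE ?norm2_ge0 ?(ltW e0)//.
exact: le_lt_trans (fD k) hk.
Qed.
End Rate.

(** * Distances and the Lagrangian *)

Section Algorithm.
Context {R : realType} {N M m : nat} {n : 'I_N -> nat}.
Variable P : convex_program R M m n.

Local Notation blocks := (forall i : 'I_N, 'cV[R]_(n i)).
Local Notation point := (primal_dual R M m n).

Definition ineq_vector (x : blocks) : 'cV[R]_M := \col_j ineq_value P x j.

Lemma sqdistC (z z' : point) : sqdist z z' = sqdist z' z.
Proof.
rewrite /sqdist /sqnorm norm2BC (norm2BC (pmu z)); congr (_ + _ + _).
by apply: eq_bigr => i _; rewrite norm2BC.
Qed.

Lemma sqnorm_ge0 (x : blocks) (lam : 'cV[R]_m) (mu : 'cV[R]_M) :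
  0 <= sqnorm x lam mu.
Proof. by rewrite !addr_ge0 ?sumr_ge0 ?sqr_ge0// => i _; exact: sqr_ge0. Qed.

Lemma sqdist_le_double (z w z' : point) :
  sqdist z z' <= 2 * (sqdist z w + sqdist w z').
Proof.
have h p (u v s : 'cV[R]_p) : norm2 (u - s) ^+ 2 <=
    2 * (norm2 (u - v) ^+ 2 + norm2 (v - s) ^+ 2).
  by rewrite -[u - s](subrKA v) norm2D_sqr_le.
rewrite /sqdist /sqnorm [leRHS](_ : _ =
    2 * (\sum_(i < N) norm2 (px z i - px w i) ^+ 2
         + \sum_(i < N) norm2 (px w i - px z' i) ^+ 2)
  + 2 * (norm2 (plam z - plam w) ^+ 2 + norm2 (plam w - plam z') ^+ 2)
  + 2 * (norm2 (pmu z - pmu w) ^+ 2 + norm2 (pmu w - pmu z') ^+ 2)).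
  rewrite lerD// lerD// -big_split mulr_sumr.
  by apply: ler_sum => i _; exact: h.
ring.
Qed.

Lemma block_sqr_le_sum (x : blocks) i :
  norm2 (x i) ^+ 2 <= \sum_(i < N) norm2 (x i) ^+ 2.
Proof.
rewrite (bigD1 i)//= lerDl; apply: sumr_ge0 => j _; exact: sqr_ge0.
Qed.

Lemma block_le_sqdist (z z' : point) i :
  norm2 (px z i - px z' i) ^+ 2 <= sqdist z z'.
Proof.
apply: le_trans (block_sqr_le_sum (fun i => px z i - px z' i) i) _.
by rewrite /sqdist /sqnorm -addrA lerDl addr_ge0 ?sqr_ge0.
Qed.

Lemma plam_le_sqdist (z z' : point) :
  norm2 (plam z - plam z') ^+ 2 <= sqdist z z'.
Proof.
rewrite /sqdist /sqnorm addrAC lerDr addr_ge0 ?sqr_ge0//.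
by apply: sumr_ge0 => j _; exact: sqr_ge0.
Qed.

Lemma pmu_le_sqdist (z z' : point) :
  norm2 (pmu z - pmu z') ^+ 2 <= sqdist z z'.
Proof.
rewrite /sqdist /sqnorm lerDr addr_ge0 ?sqr_ge0//.
by apply: sumr_ge0 => j _; exact: sqr_ge0.
Qed.

Lemma lagrangianE (x : blocks) lam mu : lagrangian P x lam mu =
  \sum_(i < N) obj P (x i) + dot lam (eq_residual P x) + dot mu (ineq_vector x).
Proof. by congr (_ + _); apply: eq_bigr => j _; rewrite mxE. Qed.

(** The part of the proximal objective of block i without the proximal
    term. *)
Definition block_lagrangian (lam : 'cV[R]_m) (mu : 'cV[R]_M) i
    (y : 'cV[R]_(n i)) : R :=
  obj P y + dot lam (eqmat P i *m y) + \sum_(j < M) mu j 0 * ineq P j y.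

Lemma lagrangian_separable (x : blocks) lam mu : lagrangian P x lam mu =
  \sum_(i < N) block_lagrangian lam mu (x i) - dot lam (rhs P).
Proof.
rewrite /lagrangian /block_lagrangian !big_split/= dotDr dotNr dot_sumr.
rewrite (eq_bigr (fun j => \sum_(i < N) mu j 0 * ineq P j (x i))).
  by rewrite [X in _ + X = _]exchange_big/=; ring.
by move=> j _; rewrite mulr_sumr.
Qed.

Lemma block_lagrangian_convex lam mu i : nonneg mu ->
  convex_function [set: 'cV[R]_(n i)] (@block_lagrangian lam mu i).
Proof.
move=> mu0; apply/convex_functionP => t x y t01; rewrite /block_lagrangian.
have /convex_functionP/(_ t x y t01) hobj := @obj_convex _ _ _ _ _ P i.
have hineq : \sum_(j < M) mu j 0 * ineq P j (t *: x + (1 - t) *: y) <=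
    t * (\sum_(j < M) mu j 0 * ineq P j x)
    + (1 - t) * (\sum_(j < M) mu j 0 * ineq P j y).
  rewrite !mulr_sumr -big_split; apply: ler_sum => j _ /=.
  have /convex_functionP/(_ t x y t01) := @ineq_convex _ _ _ _ _ P j i.
  by move/(ler_wpM2l (mu0 j)); lra.
rewrite mulmxDr -!scalemxAr !dotE; lra.
Qed.

(** * The predictor point *)

Lemma mu_step_ge0 rho (mu : 'cV[R]_M) (x : blocks) :
  nonneg (mu_step P rho mu x).
Proof. by move=> j; rewrite mxE le_max lexx. Qed.

Lemma mu_step_vi rho (mu v : 'cV[R]_M) (x : blocks) : nonneg v ->
  dot (v - mu_step P rho mu x)
    (mu + rho *: ineq_vector x - mu_step P rho mu x) <= 0.
Proof.
move=> v0; rewrite (_ : mu_step P rho mu x =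
  \col_j Num.max 0 ((mu + rho *: ineq_vector x) j 0)) ?proj_orthant_vi//.
by apply/matrixP => j k; rewrite !mxE.
Qed.

(** The multiplier of the equality constraints is not projected, so its
    variational inequality is trivial; it is stated in this form to be fed to
    the same inequality as mu. *)
Lemma lambda_step_vi rho (lam v : 'cV[R]_m) (x : blocks) :
  dot (v - lambda_step P rho lam x)
    (lam + rho *: eq_residual P x - lambda_step P rho lam x) <= 0.
Proof. by rewrite subrr dot0r. Qed.

Definition predictor_point rho (z z' : point) : point :=
  PrimalDual (px z') (lambda_step P rho (plam z) (px z))
    (mu_step P rho (pmu z) (px z)).

(** The blocks are minimized separately, but against the common multipliers
    gamma and nu, and the Lagrangian is separable: the sum of the block
    conditions is a statement on the whole Lagrangian at w. *)
Lemma primal_step_optimality rho (z z' : point) (y : blocks) :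
  0 < rho -> NPCPM_step P rho z z' -> primal_feasible P y ->
  let w := predictor_point rho z z' in
  lagrangian P (px w) (plam w) (pmu w) <= lagrangian P y (plam w) (pmu w)
    + rho^-1 * \sum_(i < N) dot (px w i - px z i) (y i - px w i).
Proof.
move=> rho0 [xmin _ _] yX /=.
rewrite !lagrangian_separable [leRHS]addrAC lerD2r mulr_sumr -big_split/=.
apply: ler_sum => i _; apply: (prox_optimality _ _ rho0 (xmin i) (yX i)).
  exact: dom_convex.
exact/block_lagrangian_convex/mu_step_ge0.
Qed.

Lemma NPCPM_step_feasible rho (z z' : point) :
  NPCPM_step P rho z z' -> primal_feasible P (px z').
Proof. by case=> xmin _ _ i; case: (xmin i). Qed.

(** The perturbations are read off from the optimality conditions of the
    predictor point: the first absorbs the gradient of the proximal term, the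
    second cancels the equality residual at x', and the third moves the
    gradient in mu from x' back to x, for which nu is the projection. *)
Lemma predictor_point_in_inverse_map rho (z z' : point) :
  0 < rho -> NPCPM_step P rho z z' ->
  let w := predictor_point rho z z' in
  inverse_map P (fun i => rho^-1 *: (px z i - px z' i))
    (rho^-1 *: (plam z - plam z'))
    (ineq_vector (px z) - ineq_vector (px z') + rho^-1 *: (pmu z - pmu w)) w.
Proof.
move=> rho0 hz w; have rn0 : rho != 0 by rewrite gt_eqF.
have rV0 : 0 < rho^-1 by rewrite invr_gt0.
split; [exact: NPCPM_step_feasible hz|exact: mu_step_ge0| |].
- move=> lam mu mu0; rewrite /perturbed_lagrangian !lagrangianE.
  have -> : rho^-1 *: (plam z - plam z') = - eq_residual P (px w).
    case: hz => _ -> _.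
    rewrite /lambda_step opprD addNKr -scalerN scalerA mulVf// scale1r.
    by [].
  have : dot (mu - pmu w)
      (ineq_vector (px z) + rho^-1 *: (pmu z - pmu w)) <= 0.
    rewrite (_ : ineq_vector (px z) + _ =
      rho^-1 *: (pmu z + rho *: ineq_vector (px z) - pmu w)).
      by rewrite dotZr pmulr_rle0// mu_step_vi.
    by apply/matrixP => j k; rewrite !mxE; field.
  rewrite !dotE; move: (pmu w) (plam w) => nu gam /=; lra.
- move=> y yX; rewrite /perturbed_lagrangian.
  have := primal_step_optimality rho0 hz yX; rewrite -/w /=.
  rewrite mulr_sumr.
  have -> : \sum_(i < N) rho^-1 * dot (px z' i - px z i) (y i - px z' i)
    = \sum_(i < N) dot (px z' i) (rho^-1 *: (px z i - px z' i))
      - \sum_(i < N) dot (y i) (rho^-1 *: (px z i - px z' i)).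
    rewrite -sumrB; apply: eq_bigr => i _.
    rewrite !dotE (dotC (px z i)) (dotC (px z i)) (dotC (px z' i) (y i)); ring.
  lra.
Qed.

(** * Descent *)

Lemma natr_mul_sum k (c : R) : k%:R * c = \sum_(i < k) c.
Proof. by rewrite sumr_const card_ord mulr_natl. Qed.

Lemma eqmat_le_A_max i y : norm2 (eqmat P i *m y) <= A_max P * norm2 y.
Proof.
apply: le_trans (norm2_mulmx_le _ _) _; rewrite ler_wpM2r ?norm2_ge0//.
exact: (le_bigmax _ (fun i => spectral_norm (eqmat P i))).
Qed.

(** Each of the N blocks contributes 2 |d| |A_i| |x_i - y_i|, split by the
    arithmetic-geometric mean; hence the factor N in front of |d|^2 only. *)
Lemma eq_residual_cross_le (d : 'cV[R]_m) (x y : blocks) :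
  2 * dot d (eq_residual P y - eq_residual P x) <=
  A_max P * (N%:R * norm2 d ^+ 2 + \sum_(i < N) norm2 (x i - y i) ^+ 2).
Proof.
have A0 : 0 <= A_max P by exact: bigmax_ge_id.
have -> : eq_residual P y - eq_residual P x =
    \sum_(i < N) eqmat P i *m (y i - x i).
  rewrite /eq_residual opprB addrA subrK -sumrB.
  by apply: eq_bigr => i _; rewrite mulmxBr.
have -> : N%:R * norm2 d ^+ 2 = \sum_(i < N) norm2 d ^+ 2.
  exact: natr_mul_sum.
rewrite dot_sumr -big_split/= !mulr_sumr; apply: ler_sum => i _.
have h1 := dot_le_norm2 d (eqmat P i *m (y i - x i)).
have h2 := eqmat_le_A_max (y i - x i); rewrite (norm2BC (x i)).
have h3 := ler_wpM2l (norm2_ge0 d) h2.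
have := mulr_ge0 A0 (sqr_ge0 (norm2 d - norm2 (y i - x i))); lra.
Qed.

Definition lipschitz_constraints (L : 'I_M -> 'I_N -> R) : Prop :=
  forall j i (x y : 'cV[R]_(n i)), dom P i x -> dom P i y ->
    `|ineq P j x - ineq P j y| <= L j i * norm2 (x - y).

Lemma lipschitz_le_L_max L j i (x y : 'cV[R]_(n i)) :
  lipschitz_constraints L -> dom P i x -> dom P i y ->
  `|ineq P j x - ineq P j y| <= L_max L * norm2 (x - y).
Proof.
move=> HL xX yX; apply: le_trans (HL j i x y xX yX) _.
rewrite ler_wpM2r ?norm2_ge0//.
apply: le_trans (le_bigmax _ (fun i => L j i) i) _.
exact: (le_bigmax _ (fun j => \big[Num.max/0]_(i < N) L j i)).
Qed.

(** There is one product for each pair (j, i): every d_j occurs N times and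
    every |x_i - y_i| occurs M times. *)
Lemma ineq_vector_cross_le L (d : 'cV[R]_M) (x y : blocks) :
  lipschitz_constraints L -> primal_feasible P x -> primal_feasible P y ->
  2 * dot d (ineq_vector y - ineq_vector x) <=
  L_max L * (N%:R * norm2 d ^+ 2
             + M%:R * \sum_(i < N) norm2 (x i - y i) ^+ 2).
Proof.
move=> HL xX yX; have L0 : 0 <= L_max L by exact: bigmax_ge_id.
rewrite norm2_sqr /dot [N%:R * _]mulr_sumr (natr_mul_sum M).
rewrite -big_split/= !mulr_sumr; apply: ler_sum => j _.
rewrite !mxE /ineq_value -sumrB (natr_mul_sum N).
rewrite -big_split/= !mulr_sumr; apply: ler_sum => i _.
have h1 : d j 0 * (ineq P j (y i) - ineq P j (x i)) <=
    `|d j 0| * (L_max L * norm2 (y i - x i)).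
  apply: le_trans (ler_norm _) _; rewrite normrM ler_wpM2l//.
  exact: lipschitz_le_L_max.
rewrite (norm2BC (x i)) -expr2 -(real_normK (num_real (d j 0))).
have := mulr_ge0 L0 (sqr_ge0 (`|d j 0| - norm2 (y i - x i))); lra.
Qed.

Lemma ineq_vector_change_le L (x y : blocks) :
  lipschitz_constraints L -> primal_feasible P x -> primal_feasible P y ->
  norm2 (ineq_vector x - ineq_vector y) ^+ 2 <=
  M%:R * (N%:R * L_max L) ^+ 2 * \sum_(i < N) norm2 (x i - y i) ^+ 2.
Proof.
move=> HL xX yX; have L0 : 0 <= L_max L by exact: bigmax_ge_id.
set S := \sum_(i < N) _.
have S0 : 0 <= S by apply: sumr_ge0 => i _; exact: sqr_ge0.
rewrite norm2_sqr -mulrA (natr_mul_sum M).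
apply: ler_sum => j _; rewrite -expr2 -(real_normK (num_real _)).
rewrite -[S in leRHS](sqr_sqrtr S0) -exprMn.
rewrite ler_pXn2r ?nnegrE ?mulr_ge0 ?sqrtr_ge0//.
rewrite !mxE /ineq_value -sumrB.
apply: le_trans (ler_norm_sum _ _ _) _.
rewrite -mulrA (natr_mul_sum N).
apply: ler_sum => i _.
apply: le_trans (lipschitz_le_L_max j HL (xX i) (yX i)) _.
rewrite ler_wpM2l// -(@ler_pXn2r _ 2) ?nnegrE ?norm2_ge0 ?sqrtr_ge0//.
by rewrite (sqr_sqrtr S0); exact: (block_sqr_le_sum (fun i => x i - y i)).
Qed.

(** The first-order terms add up to the difference of the Lagrangian at
    (x', gamma, nu) and at x' with the multipliers of zs.  The saddle
    inequalities for zs and the optimality of x' bound it by the proximal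
    inner products (this is gap), which cancel against the expansion of the
    primal distance. *)
Lemma sqdist_descent L eps rho (z z' zs : point) :
  lipschitz_constraints L -> saddle_points P (lagrangian P) zs ->
  0 < rho -> rho * (A_max P + M%:R * L_max L) <= 1 - eps ->
  rho * (N%:R * A_max P) <= 1 - eps -> rho * (N%:R * L_max L) <= 1 - eps ->
  eps <= 1 ->
  primal_feasible P (px z) -> NPCPM_step P rho z z' ->
  let w := predictor_point rho z z' in
  sqdist z' zs <= sqdist z zs - eps * (sqdist z w + sqdist w z').
Proof.
move=> HL [sX s0 smax smin] rho0 bx blam bmu eps1 zX hz.
set w := predictor_point _ _ _; move=> /=.
have rn0 : rho != 0 by rewrite gt_eqF.
have z'X := NPCPM_step_feasible hz.
have w0 : nonneg (pmu w) by exact: mu_step_ge0.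
have gap : dot (plam w - plam zs) (eq_residual P (px z'))
    + dot (pmu w - pmu zs) (ineq_vector (px z'))
    <= rho^-1 * \sum_(i < N) dot (px z' i - px z i) (px zs i - px z' i).
  have := primal_step_optimality rho0 hz sX.
  have := smax (plam w) (pmu w) w0.
  have := smin (px z') z'X.
  rewrite -/w /= !lagrangianE !dotE; lra.
have [_ lamE muE] := hz.
have hlam : norm2 (plam z' - plam zs) ^+ 2 <= norm2 (plam z - plam zs) ^+ 2
    - (norm2 (plam z - plam w) ^+ 2 + norm2 (plam w - plam z') ^+ 2)
    + 2 * rho * dot (plam w - plam zs) (eq_residual P (px z'))
    + 2 * rho * dot (plam z' - plam w)
        (eq_residual P (px z') - eq_residual P (px z)).
  apply: extragradient_inequality; first exact: lambda_step_vi.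
  by rewrite lamE; exact: lambda_step_vi.
have hmu : norm2 (pmu z' - pmu zs) ^+ 2 <= norm2 (pmu z - pmu zs) ^+ 2
    - (norm2 (pmu z - pmu w) ^+ 2 + norm2 (pmu w - pmu z') ^+ 2)
    + 2 * rho * dot (pmu w - pmu zs) (ineq_vector (px z'))
    + 2 * rho * dot (pmu z' - pmu w)
        (ineq_vector (px z') - ineq_vector (px z)).
  apply: extragradient_inequality.
    by apply: mu_step_vi; rewrite muE; exact: mu_step_ge0.
  by rewrite muE; exact: mu_step_vi.
have hx : \sum_(i < N) norm2 (px z' i - px zs i) ^+ 2 =
    \sum_(i < N) norm2 (px z i - px zs i) ^+ 2
    - \sum_(i < N) norm2 (px z i - px z' i) ^+ 2
    - 2 * \sum_(i < N) dot (px z' i - px z i) (px zs i - px z' i).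
  rewrite mulr_sumr -!sumrB; apply: eq_bigr => i _.
  exact: three_point_identity.
have clam := eq_residual_cross_le (plam z' - plam w) (px z) (px z').
have cmu := ineq_vector_cross_le (pmu z' - pmu w) HL zX z'X.
rewrite /sqdist /sqnorm hx.
(* w and z' have the same primal part. *)
have wx : \sum_(i < N) norm2 (px w i - px z' i) ^+ 2 = 0.
  by apply: big1 => i _; rewrite subrr norm2_0 expr0n.
rewrite wx [px w]/=.
move: gap clam cmu hlam hmu.
rewrite (norm2BC (plam z')) (norm2BC (pmu z') (pmu w)) mulrC ler_pdivlMr//.
have := sqr_ge0 (norm2 (plam w - plam z')).
have := sqr_ge0 (norm2 (pmu w - pmu z')).
have := sqr_ge0 (norm2 (plam z - plam w)).
have := sqr_ge0 (norm2 (pmu z - pmu w)).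
have : 0 <= \sum_(i < N) norm2 (px z i - px z' i) ^+ 2.
  by apply: sumr_ge0 => i _; exact: sqr_ge0.
move=> /ler_wpM2r hX hmu0 hlam0 /ler_wpM2r hM /ler_wpM2r hL gap.
move=> /(ler_wpM2l (ltW rho0)) clam /(ler_wpM2l (ltW rho0)) cmu hlam hmu.
move: (hX _ _ bx) (hL _ _ blam) (hM _ _ bmu) => {}hX {}hL {}hM.
move: (ler_wpM2r hmu0 eps1) (ler_wpM2r hlam0 eps1) => emu elam.
lra.
Qed.

(** * The error bound *)

(** The residuals are differences of consecutive quantities divided by rho,
    except for the change of the constraint values in the mu part; since
    rho N L_max <= 1, the latter is also of order |x - x'| / rho. *)
Lemma predictor_residual_le L rho (z z' : point) :
  lipschitz_constraints L -> 0 < rho -> rho * (N%:R * L_max L) <= 1 ->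
  primal_feasible P (px z) -> NPCPM_step P rho z z' ->
  let w := predictor_point rho z z' in
  sqnorm (fun i => rho^-1 *: (px z i - px z' i))
    (rho^-1 *: (plam z - plam z'))
    (ineq_vector (px z) - ineq_vector (px z') + rho^-1 *: (pmu z - pmu w))
  <= 2 * (M%:R + 1) * rho^-1 ^+ 2 * (sqdist z w + sqdist w z').
Proof.
move=> HL rho0 bmu zX hz; set w := predictor_point _ _ _; move=> /=.
have z'X := NPCPM_step_feasible hz.
have L0 : 0 <= L_max L by exact: bigmax_ge_id.
have r0 : 0 <= rho^-1 by rewrite invr_ge0 ltW.
set r2 := rho^-1 ^+ 2; have r20 : 0 <= r2 by exact: sqr_ge0.
pose S := \sum_(i < N) norm2 (px z i - px z' i) ^+ 2.
have S0 : 0 <= S by apply: sumr_ge0 => i _; exact: sqr_ge0.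
have hg : norm2 (ineq_vector (px z) - ineq_vector (px z')) ^+ 2
    <= M%:R * (r2 * S).
  apply: le_trans (ineq_vector_change_le HL zX z'X) _.
  rewrite -mulrA ler_wpM2l// ler_wpM2r//.
  by rewrite ler_pXn2r ?nnegrE ?mulr_ge0// -(ler_pM2l rho0) mulfV ?gt_eqF.
have hu : \sum_(i < N) norm2 (rho^-1 *: (px z i - px z' i)) ^+ 2 = r2 * S.
  rewrite mulr_sumr; apply: eq_bigr => i _.
  by rewrite norm2Z exprMn real_normK ?num_real.
have hv : norm2 (rho^-1 *: (plam z - plam z')) ^+ 2 <= r2 *
    (2 * (norm2 (plam z - plam w) ^+ 2 + norm2 (plam w - plam z') ^+ 2)).
  rewrite norm2Z exprMn real_normK ?num_real// ler_wpM2l//.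
  by rewrite -[plam z - plam z'](subrKA (plam w)) norm2D_sqr_le.
have hw : norm2 (ineq_vector (px z) - ineq_vector (px z')
      + rho^-1 *: (pmu z - pmu w)) ^+ 2 <=
    2 * (M%:R * (r2 * S) + r2 * norm2 (pmu z - pmu w) ^+ 2).
  apply: le_trans (norm2D_sqr_le _ _) _; rewrite ler_wpM2l// lerD//.
  by rewrite norm2Z exprMn real_normK ?num_real.
have E1 : S + norm2 (plam z - plam w) ^+ 2 + norm2 (pmu z - pmu w) ^+ 2
    + (norm2 (plam w - plam z') ^+ 2 + norm2 (pmu w - pmu z') ^+ 2)
    <= sqdist z w + sqdist w z'.
  rewrite /sqdist /sqnorm -/S lerD2l -[leRHS]addrA lerDr.
  by apply: sumr_ge0 => i _; exact: sqr_ge0.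
have M0 : 0 <= M%:R :> R by [].
have C0 : 0 <= 2 * (M%:R + 1) * r2 by rewrite !mulr_ge0 ?addr_ge0.
apply: le_trans (ler_wpM2l C0 E1); rewrite /sqnorm hu.
have := mulr_ge0 r20 S0.
have h p (t : 'cV[R]_p) := mulr_ge0 (mulr_ge0 M0 r20) (sqr_ge0 (norm2 t)).
have := h _ (plam z - plam w); have := h _ (plam w - plam z').
have := h _ (pmu z - pmu w); have := h _ (pmu w - pmu z').
have := mulr_ge0 r20 (sqr_ge0 (norm2 (pmu w - pmu z'))).
lra.
Qed.

Lemma sqdist_next_le rho (a tau : R) (z z' zs : point) :
  (forall u v w y, inverse_map P u v w y -> sqnorm u v w <= tau ^+ 2 ->
     sqdist y zs <= a ^+ 2 * sqnorm u v w) ->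
  forall L, lipschitz_constraints L ->
  0 < rho -> rho * (N%:R * L_max L) <= 1 ->
  primal_feasible P (px z) -> NPCPM_step P rho z z' ->
  let C := 2 * (M%:R + 1) * rho^-1 ^+ 2 in
  let w := predictor_point rho z z' in
  let E := sqdist z w + sqdist w z' in
  C * E <= tau ^+ 2 -> sqdist z' zs <= 2 * (a ^+ 2 * C + 1) * E.
Proof.
move=> Hinv L HL rho0 bmu zX hz C w E hE.
have res := predictor_residual_le HL rho0 bmu zX hz.
have := Hinv _ _ _ _ (predictor_point_in_inverse_map rho0 hz) (le_trans res hE).
move=> /le_trans/(_ (ler_wpM2l (sqr_ge0 a) res)); rewrite -/w -/C -/E => hw.
apply: le_trans (sqdist_le_double z' w zs) _; rewrite (sqdistC z').
have : 0 <= sqdist z w by exact: sqnorm_ge0.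
rewrite -/C in hw; move: hw; rewrite /E; lra.
Qed.

End Algorithm.

(** * Linear convergence *)

Theorem theorem2p5 (R : realType) (N M m : nat) (n : 'I_N -> nat)
  (P : convex_program R M m n)
  (L : 'I_M -> 'I_N -> R) (zs : primal_dual R M m n)
  (tau a eps rho : R) (z : nat -> primal_dual R M m n)
  (Hslater : slater P)
  (HL : forall j i (x y : 'cV[R]_(n i)), dom P i x -> dom P i y ->
     `|ineq P j x - ineq P j y| <= L j i * norm2 (x - y))
  (Hsaddle : saddle_points P (lagrangian P) zs)
  (Hunique : forall z', saddle_points P (lagrangian P) z' -> z' = zs)
  (Htau : 0 < tau) (Ha : 0 <= a)
  (Hinverse : forall u v w z', inverse_map P u v w z' ->
     sqnorm u v w <= tau ^+ 2 ->
     sqdist z' zs <= a ^+ 2 * sqnorm u v w)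
  (Heps : 0 < eps < 1)
  (Hrho : 0 < rho) (Hrho_le : (rho%:E <= step_bound P eps L)%E)
  (Hz : NPCPM_sequence P rho z) :
  [/\ forall i, px (z k) i @[k --> \oo] --> px zs i,
      plam (z k) @[k --> \oo] --> plam zs,
      pmu (z k) @[k --> \oo] --> pmu zs &
      exists (theta : R) (kbar : nat), 0 < theta < 1 /\
        forall k, (kbar <= k)%N ->
          sqdist (z k.+1) zs <= theta ^+ 2 * sqdist (z k) zs].
Proof.
case/andP: Heps => eps0 eps1.
case: (step_boundP eps1 Hrho_le) => bx blam bmu.
have feas k : primal_feasible P (px (z k.+1)) := NPCPM_step_feasible (Hz k).
have bmu1 : rho * (N%:R * L_max L) <= 1.
  by apply: le_trans bmu _; rewrite gerBl ltW.
pose D k := sqdist (z k) zs.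
pose E k := let w := predictor_point P rho (z k) (z k.+1) in
  sqdist (z k) w + sqdist w (z k.+1).
pose C : R := 2 * (M%:R + 1) * rho^-1 ^+ 2.
have C0 : 0 < C.
  by rewrite !mulr_gt0 ?exprn_gt0 ?invr_gt0// ltr_wpDl.
have B0 : 0 < 2 * (a ^+ 2 * C + 1).
  by rewrite mulr_gt0// ltr_wpDl// mulr_ge0 ?sqr_ge0// ltW.
have del0 : 0 < tau ^+ 2 / C by rewrite divr_gt0// exprn_gt0.
have descent k : D k.+2 <= D k.+1 - eps * E k.+1.
  exact: (sqdist_descent HL Hsaddle Hrho bx blam bmu (ltW eps1) (feas k)).
have errbound k : E k.+1 <= tau ^+ 2 / C ->
    D k.+2 <= 2 * (a ^+ 2 * C + 1) * E k.+1.
  rewrite ler_pdivlMr// mulrC.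
  exact: (sqdist_next_le Hinverse HL Hrho bmu1 (feas k) (Hz k.+1)).
have D0 k : 0 <= D k by exact: sqnorm_ge0.
have E0 k : 0 <= E k by rewrite addr_ge0 ?sqnorm_ge0.
have [Dcvg rate] :=
  linear_rate_of_descent eps0 B0 del0 D0 E0 descent errbound.
split=> [i| | |//]; apply: (cvg_of_norm2 Dcvg) => k.
- exact: block_le_sqdist.
- exact: plam_le_sqdist.
- exact: pmu_le_sqdist.
Qed.
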